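(* In the class of all graphs, $2$-colorability is expressible in the modal language of graph theory: there is a sentence $\rho_2\in\Diamond\mathcal{L}_\sim$ such that for every graph $G$, $$G\models\rho_2\quad\text{if and only if}\quad G\text{ is }2\text{-colorable}.$$ Similarly, for every finite number $k$ there is a sentence $\rho_k\in\Diamond\mathcal{L}_\sim$ such that for every graph $G$, $G\models\rho_k$ if and only if $G$ is $k$-colorable.
   Context: A graph is a set of vertices (of any cardinality) together with an irreflexive symmetric binary edge relation $\sim$. $\mathcal{L}_\sim$ is the first-order language (with equality) whose only non-logical symbol is the binary relation symbol $\sim$. $\Diamond\mathcal{L}_\sim$ is the closure of the set of $\mathcal{L}_\sim$-formulas under the modal operators $\Diamond,\Box$ and Boolean connectives, but not quantifiers (so no modal operator occurs in the scope of a quantifier). Formulas are evaluated at graphs, within the class of all graphs under the substructure relation: $G\models\Diamond\varphi[\bar a]$ iff there is a graph $H$ containing $G$ as a substructure (i.e. $G$ is an induced subgraph of $H$) with $H\models\varphi[\bar a]$; $G\models\Box\varphi[\bar a]$ iff $H\models\varphi[\bar a]$ for every graph $H$ containing $G$ as a substructure; Boolean connectives and first-order formulas are interpreted as usual in $G$. A graph is $k$-colorable if its vertices can be assigned one of $k$ colors so that adjacent vertices have different colors. *)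

(* Defs.v *)
From mathcomp Require Import all_boot.

Set Implicit Arguments.
Unset Strict Implicit.
Unset Printing Implicit Defensive.

Record graph := Graph {
  vertex :> Type;
  adj : vertex -> vertex -> Prop;
  adj_sym : forall x y, adj x y -> adj y x;
  adj_irrefl : forall x, ~ adj x x
}.

(* [G] is an induced subgraph of [H] up to renaming of vertices: since types
   have no inclusion relation, the inclusion map is given explicitly.  Truth of
   formulas is transported along this map. *)
Record embedding (G H : graph) := Embedding {
  emb :> G -> H;
  emb_inj : injective emb;
  emb_adj : forall x y, adj (emb x) (emb y) <-> adj x y
}.

(* Well-scoped de Bruijn syntax: [fo n] has its free variables among
   [0, ..., n-1], and a quantifier binds variable [0] of its body.  Sentences
   are thus evaluated without a choice of default vertex, which the empty graph
   could not provide. *)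
Inductive fo (n : nat) : Type :=
| FoFalse
| FoEq (i j : 'I_n)
| FoAdj (i j : 'I_n)
| FoNot (phi : fo n)
| FoAnd (phi psi : fo n)
| FoOr (phi psi : fo n)
| FoImp (phi psi : fo n)
| FoAll (phi : fo n.+1)
| FoEx (phi : fo n.+1).

Inductive modal (n : nat) : Type :=
| Fo (phi : fo n)
| Not (phi : modal n)
| And (phi psi : modal n)
| Or (phi psi : modal n)
| Imp (phi psi : modal n)
| Dia (phi : modal n)
| Box (phi : modal n).

Definition sentence := modal 0.

Definition extend (V : Type) (n : nat) (v : V) (a : 'I_n -> V) : 'I_n.+1 -> V :=
  fun i => oapp a v (unlift ord0 i).

Fixpoint fo_sat (G : graph) (n : nat) (phi : fo n) : ('I_n -> G) -> Prop :=
  match phi with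
  | FoFalse => fun _ => False
  | FoEq i j => fun a => a i = a j
  | FoAdj i j => fun a => adj (a i) (a j)
  | FoNot phi => fun a => ~ fo_sat phi a
  | FoAnd phi psi => fun a => fo_sat phi a /\ fo_sat psi a
  | FoOr phi psi => fun a => fo_sat phi a \/ fo_sat psi a
  | FoImp phi psi => fun a => fo_sat phi a -> fo_sat psi a
  | FoAll phi => fun a => forall v : G, fo_sat phi (extend v a)
  | FoEx phi => fun a => exists v : G, fo_sat phi (extend v a)
  end.

Fixpoint sat (G : graph) (n : nat) (phi : modal n) (a : 'I_n -> G) : Prop :=
  match phi with
  | Fo phi => fo_sat phi a
  | Not phi => ~ sat phi a
  | And phi psi => sat phi a /\ sat psi a
  | Or phi psi => sat phi a \/ sat psi a
  | Imp phi psi => sat phi a -> sat psi a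
  | Dia phi => exists (H : graph) (e : embedding G H), sat phi (e \o a)
  | Box phi => forall (H : graph) (e : embedding G H), sat phi (e \o a)
  end.

Definition no_variables (V : Type) (i : 'I_0) : V :=
  match notF (ltn_ord i) with end.

Definition models (G : graph) (rho : sentence) : Prop :=
  sat rho (@no_variables G).

Definition colorable (k : nat) (G : graph) : Prop :=
  exists c : G -> 'I_k, forall x y, adj x y -> c x <> c y.

(* Main.v *)
(** Truth of [Dia phi] for a first-order sentence [phi] only requires [phi] in
    some extension, and [k]-colorability is inherited by induced subgraphs.  So
    it suffices that [phi] implies [k]-colorability and that every
    [k]-colorable graph extends to a model of [phi].  Let [phi] say that there
    are vertices [c_0, ..., c_{k-1}] such that every vertex misses (is
    non-adjacent to) some [c_i] and adjacent vertices never miss a common [c_i].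
    In a model, giving [x] a color [i] such that [x] misses [c_i] is a proper
    coloring.  Conversely, to a [k]-colored graph add one new vertex [c_i] of
    each color [i], adjacent to exactly the vertices of the other colors. *)
Require Import Defs.
From mathcomp Require Import all_boot.
From mathcomp Require Import boolp.

Set Implicit Arguments.
Unset Strict Implicit.
Unset Printing Implicit Defensive.

Lemma extend0 (V : Type) n (v : V) (a : 'I_n -> V) : extend v a ord0 = v.
Proof. by rewrite /extend unlift_none. Qed.

Lemma extend_lift (V : Type) n (v : V) (a : 'I_n -> V) i :
  extend v a (lift ord0 i) = a i.
Proof. by rewrite /extend liftK. Qed.

Lemma extend_eta (V : Type) n (a : 'I_n.+1 -> V) :
  extend (a ord0) (fun i => a (lift ord0 i)) = a.
Proof. by apply/funext => i; rewrite /extend; case: unliftP => [j|] ->. Qed.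

(** The vertices c_i stay free variables until the end, so that [coloring_fo] can be tested at an
    explicit assignment; closing it gives the sentence to put under [Dia]. *)
Fixpoint ex_closure n : fo n -> fo 0 :=
  if n is m.+1 then fun phi => ex_closure (FoEx phi) else fun phi => phi.

Lemma fo_sat_ex_closure (G : graph) n (phi : fo n) (a0 : 'I_0 -> G) :
  fo_sat (ex_closure phi) a0 <-> exists a : 'I_n -> G, fo_sat phi a.
Proof.
elim: n phi => [|n IHn] phi /=.
  split=> [phi_a0 | [a]]; first by exists a0.
  by have -> : a = a0 by apply/funext => -[].
split=> [/IHn[a [v phi_va]] | [a phi_a]]; first by exists (extend v a).
apply/IHn; exists (fun i => a (lift ord0 i)), (a ord0).
by rewrite extend_eta.
Qed.

Lemma fo_sat_bigor (G : graph) n (I : finType) (phi : I -> fo n)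
    (a : 'I_n -> G) :
  fo_sat (\big[@FoOr n/FoFalse n]_i phi i) a <-> exists i, fo_sat (phi i) a.
Proof.
(* The induction runs over an arbitrary list in place of the enumeration, so the witness must be
   tracked as a member of that list. *)
have mem_sat : fo_sat (\big[@FoOr n/FoFalse n]_i phi i) a <->
    exists2 i, i \in index_enum I & fo_sat (phi i) a.
  elim: (index_enum I) => [|i r IHr]; first by rewrite big_nil; split=> // -[].
  rewrite big_cons /=; split.
    case=> [phi_i | /IHr[j rj phi_j]]; first by exists i; rewrite ?mem_head.
    by exists j; rewrite // inE rj orbT.
  case=> j; rewrite inE => /predU1P[-> | rj] phi_j; first by left.
  by right; apply/IHr; exists j.
by rewrite mem_sat; split=> [[i _] | [i]] phi_i; exists i.
Qed.

Section ColoringFormula.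

Variable k : nat.

(** Free variable [i] stands for c_i and is shifted by [lift ord0] under each quantifier. For k = 0
    the disjunction is empty, hence false, and only the empty graph qualifies. *)
Definition covering_fo : fo k :=
  FoAll (\big[@FoOr _/FoFalse _]_(i < k) FoNot (FoAdj ord0 (lift ord0 i))).

Definition proper_fo : fo k :=
  let x := lift ord0 ord0 in
  let y := ord0 in
  let c i := lift ord0 (lift ord0 i) in
  FoAll (FoAll (FoImp (FoAdj x y) (FoNot
    (\big[@FoOr _/FoFalse _]_(i < k)
       FoAnd (FoNot (FoAdj x (c i))) (FoNot (FoAdj y (c i))))))).

Definition coloring_fo : fo k := FoAnd covering_fo proper_fo.

Lemma fo_sat_coloring (G : graph) (a : 'I_k -> G) :
  fo_sat coloring_fo a <->
    (forall x, exists i, ~ adj x (a i)) /\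
    (forall x y, adj x y -> ~ exists i, ~ adj x (a i) /\ ~ adj y (a i)).
Proof.
split=> /= -[cover proper]; split.
- move=> x; have /fo_sat_bigor[i /=] := cover x.
  by rewrite extend0 extend_lift; exists i.
- move=> x y xy [i missed]; apply: (proper x y).
    by rewrite extend_lift !extend0.
  by apply/fo_sat_bigor; exists i; rewrite /= !extend_lift !extend0.
- move=> x; apply/fo_sat_bigor; have [i xi] := cover x; exists i.
  by rewrite /= extend0 extend_lift.
- move=> x y; rewrite extend_lift !extend0 => xy /fo_sat_bigor[i] /=.
  by rewrite !extend_lift !extend0 => missed; apply: (proper x y xy); exists i.
Qed.

Lemma coloring_fo_colorable (G : graph) (a : 'I_k -> G) :
  fo_sat coloring_fo a -> colorable k G.
Proof.
(* [choice] selects a missed index for all vertices at once, whatever the cardinality of the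
   graph. *)
case/fo_sat_coloring=> /choice[c miss] proper; exists c => x y xy cxy.
by apply: (proper x y xy); exists (c x); split=> //; rewrite cxy.
Qed.

Lemma colorable_embedding (G H : graph) (e : embedding G H) :
  colorable k H -> colorable k G.
Proof. by case=> c proper; exists (c \o e) => x y /(emb_adj e)/proper. Qed.

Section Palette.

Variables (G : graph) (c : G -> 'I_k).
Hypothesis proper_c : forall x y, adj x y -> c x <> c y.

Definition palette_color (u : G + 'I_k) : 'I_k :=
  match u with inl x => c x | inr i => i end.

(** Old vertices keep their adjacency, whatever their colors, so that [inl] is an induced embedding;
    the new vertices form a complete graph. *)
Definition palette_adj (u v : G + 'I_k) : Prop :=
  match u, v with
  | inl x, inl y => adj x y
  | _, _ => palette_color u <> palette_color v
  end.

Lemma palette_adj_color u v :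
  palette_adj u v -> palette_color u <> palette_color v.
Proof. by case: u v => [x|i] [y|j] //=; apply: proper_c. Qed.

Lemma palette_adj_sym u v : palette_adj u v -> palette_adj v u.
Proof.
by case: u v => [x|i] [y|j] //= => [/adj_sym|||] // uv /esym.
Qed.

Lemma palette_adj_irrefl u : ~ palette_adj u u.
Proof. by move/palette_adj_color. Qed.

Definition palette_graph : graph :=
  Graph palette_adj_sym palette_adj_irrefl.

Lemma inl_palette_inj : injective (inl : G -> palette_graph).
Proof. by move=> x y []. Qed.

Lemma inl_palette_adj (x y : G) :
  adj (inl x : palette_graph) (inl y) <-> adj x y.
Proof. by []. Qed.

Definition palette_embedding : embedding G palette_graph :=
  Embedding inl_palette_inj inl_palette_adj.

(** Color alone decides adjacency to a new vertex, for old and new [u] alike, so each vertex misses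
    only the new vertex of its own color. *)
Lemma palette_adj_inr (u : palette_graph) i :
  adj u (inr i) <-> palette_color u <> i.
Proof. by case: u. Qed.

Lemma palette_coloring_fo :
  fo_sat coloring_fo (inr : 'I_k -> palette_graph).
Proof.
apply/fo_sat_coloring; split=> [u | u v uv [i]].
  by exists (palette_color u); rewrite palette_adj_inr.
(* By double negation, missing c_i means having color [i], so the edge [uv] would join two vertices
   of equal color. *)
rewrite !palette_adj_inr => -[/contrapT ui /contrapT vi].
by apply: (palette_adj_color uv); rewrite ui vi.
Qed.

End Palette.

Definition colorable_sentence : sentence := Dia (Fo (ex_closure coloring_fo)).

Lemma models_colorable_sentence (G : graph) :
  models G colorable_sentence <-> colorable k G.
Proof.
split=> [[H [e /fo_sat_ex_closure[a sat_a]]] | [c proper]].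
  exact: (colorable_embedding e (coloring_fo_colorable sat_a)).
exists (palette_graph proper), (palette_embedding proper).
by apply/fo_sat_ex_closure; exists inr; apply: palette_coloring_fo.
Qed.

End ColoringFormula.

Theorem theorem1 :
  (exists rho2 : sentence, forall G : graph, models G rho2 <-> colorable 2 G) /\
  (forall k : nat, exists rho : sentence,
     forall G : graph, models G rho <-> colorable k G).
Proof.
have expressible k : exists rho : sentence,
    forall G : graph, models G rho <-> colorable k G.
  by exists (colorable_sentence k) => G; apply: models_colorable_sentence.
by split; first apply: expressible.
Qed.
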